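(* Let $n\geq1$, let $g=g(x^1,\dots,x^n)$ be a $\mathcal{C}^\infty$-smooth function from $\mathbb{K}^n$ to $\mathbb{K}$, let $f=f(y)$ be a $\mathcal{C}^\infty$-smooth function from $\mathbb{K}$ to $\mathbb{K}$, and let $h(x^1,\dots,x^n):=f(g(x^1,\dots,x^n))$. For every integer $\kappa\geq1$ and every choice of indices $i_1,\dots,i_\kappa\in\{1,\dots,n\}$, the partial derivative of $h$ with respect to $x^{i_1},\dots,x^{i_\kappa}$ is given by the following explicit polynomial with integer coefficients in the derivatives of $f$ (evaluated at $y=g(x)$) and the partial derivatives of $g$: $$ \begin{aligned} \frac{\partial^\kappa h}{\partial x^{i_1}\cdots\partial x^{i_\kappa}} &=\sum_{d=1}^\kappa\ \sum_{1\leq\lambda_1<\cdots<\lambda_d\leq\kappa}\ \sum_{\substack{\mu_1\geq1,\dots,\mu_d\geq1\\ \mu_1\lambda_1+\cdots+\mu_d\lambda_d=\kappa}}\ \frac{d^{\mu_1+\cdots+\mu_d}f}{dy^{\mu_1+\cdots+\mu_d}}\\ &\Bigg[\sum_{\sigma\in\mathfrak{F}_\kappa^{(\mu_1,\lambda_1),\dots,(\mu_d,\lambda_d)}}\ \prod_{1\leq\nu_1\leq\mu_1}\frac{\partial^{\lambda_1}g}{\partial x^{i_{\sigma(1:\nu_1:1)}}\cdots\partial x^{i_{\sigma(1:\nu_1:\lambda_1)}}}\ \cdots \prod_{1\leq\nu_d\leq\mu_d}\frac{\partial^{\lambda_d}g}{\partial x^{i_{\sigma(d:\nu_d:1)}}\cdots\partial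 x^{i_{\sigma(d:\nu_d:\lambda_d)}}}\Bigg]. \end{aligned} $$
   Context: $\mathbb{K}=\mathbb{R}$ or $\mathbb{C}$. Given integers $1\le\lambda_1<\cdots<\lambda_d$ and $\mu_1,\dots,\mu_d\geq1$ with $\sum_e\mu_e\lambda_e=\kappa$, identify $\{1,\dots,\kappa\}$ with the set of triples $e\!:\!\nu\!:\!\gamma$ ($1\leq e\leq d$, $1\leq\nu\leq\mu_e$, $1\leq\gamma\leq\lambda_e$) listed in lexicographic order $1\!:\!1\!:\!1,\dots,1\!:\!1\!:\!\lambda_1,\dots,1\!:\!\mu_1\!:\!\lambda_1,\dots,d\!:\!1\!:\!1,\dots,d\!:\!\mu_d\!:\!\lambda_d$. Let $\mathfrak{S}_\kappa$ be the permutation group of $\{1,\dots,\kappa\}$ and let $\mathfrak{H}_\kappa^{(\mu_1,\lambda_1),\dots,(\mu_d,\lambda_d)}$ be the subgroup of those permutations which, for each $e$, permute among themselves the $\mu_e$ blocks $\{e\!:\!\nu\!:\!1,\dots,e\!:\!\nu\!:\!\lambda_e\}$, $1\leq\nu\leq\mu_e$ (so arbitrary permutations inside each block, composed with arbitrary permutations of the $\mu_e$ blocks); its cardinality is $\mu_1!(\lambda_1!)^{\mu_1}\cdots\mu_d!(\lambda_d!)^{\mu_d}$. Then $\mathfrak{F}_\kappa^{(\mu_1,\lambda_1),\dots,(\mu_d,\lambda_d)}:=\mathfrak{S}_\kappa/\mathfrak{H}_\kappa^{(\mu_1,\lambda_1),\dots,(\mu_d,\lambda_d)}$, and a sum over $\sigma\in\mathfrak{F}_\kappa^{\dots}$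 means a sum over an arbitrary complete set of representatives $\sigma$ of the cosets $\sigma\mathfrak{H}=\{\sigma\circ h:h\in\mathfrak{H}\}$. *)

(* Defs.v *)
From HB Require Import structures.
From mathcomp Require Import all_boot all_order all_algebra all_fingroup.
From mathcomp Require Import all_classical all_reals all_analysis.
From mathcomp Require Import complex.

Set Implicit Arguments.
Unset Strict Implicit.
Unset Printing Implicit Defensive.

Import Order.TTheory GRing.Theory Num.Theory.
Import numFieldNormedType.Exports.

Local Open Scope ring_scope.

Section Smooth.
Variable K : numFieldType.

(* partials [:: i_1; ...; i_k] g = d^k g / dx^{i_1} ... dx^{i_k}, the
   derivative with respect to x^{i_k} being taken first. The directional
   derivative 'D_v is the limit of h^-1 *: (g (h *: v + x) - g x) for h in K,
   so that over K = R[i] this is the complex (holomorphic) partial derivative. *)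
Definition partials (n : nat) (s : seq 'I_n) (g : 'rV[K]_n -> K) :
    'rV[K]_n -> K :=
  foldr (fun i u => 'D_('e_i) u) g s.

Definition smooth (n : nat) (g : 'rV[K]_n -> K) : Prop :=
  forall s : seq 'I_n,
    continuous (partials s g) /\
    forall (i : 'I_n) (x : 'rV[K]_n), derivable (partials s g) x 'e_i.

Definition smooth1 (f : K -> K) : Prop :=
  forall m : nat,
    continuous (derive1n m f) /\
    forall y : K, derivable (derive1n m f) y 1.

End Smooth.

Section Blocks.
Variables (kappa d : nat).
Hypothesis kappa_gt0 : (0 < kappa)%N.
(* The values lam e and mu e are natural numbers bounded by kappa: for mu this
   is no restriction, as mu e * lam e <= kappa and lam e >= 1. *)
Implicit Types lam mu : {ffun 'I_d -> 'I_kappa.+1}.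

Definition increasing lam : bool :=
  [forall e : 'I_d, (0 < lam e)%N] &&
  [forall e : 'I_d, forall e' : 'I_d, (e < e')%N ==> (lam e < lam e')%N].

Definition multiplicities lam mu : bool :=
  [forall e : 'I_d, (0 < mu e)%N] && ((\sum_(e < d) mu e * lam e)%N == kappa).

(* Rank, counted from 0, of e:nu:gamma in the lexicographic order, where
   e, nu and gamma are also counted from 0. *)
Definition triple_rank lam mu (e : 'I_d) (nu : 'I_(mu e))
    (gamma : 'I_(lam e)) : nat :=
  (\sum_(e' < d | (e' < e)%N) mu e' * lam e' + nu * lam e + gamma)%N.

(* The default value of insubd is irrelevant as soon as
   \sum_e mu e * lam e = kappa: see val_triple. *)
Definition triple lam mu (e : 'I_d) (nu : 'I_(mu e)) (gamma : 'I_(lam e)) :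
    'I_kappa :=
  insubd (Ordinal kappa_gt0) (triple_rank nu gamma).

Lemma val_triple lam mu (e : 'I_d) (nu : 'I_(mu e)) (gamma : 'I_(lam e)) :
  multiplicities lam mu -> triple nu gamma = triple_rank nu gamma :> nat.
Proof.
move=> /andP[_ /eqP Hs]; rewrite /triple val_insubd ifT //.
rewrite -[X in (_ < X)%N]Hs (bigID (fun e' : 'I_d => (e' < e)%N)) /=.
rewrite /triple_rank -addnA ltn_add2l.
rewrite (bigD1 e) /= ?ltnn //.
apply: (@leq_trans (nu.+1 * lam e)); last first.
  by apply: leq_trans (leq_addr _ _); rewrite leq_mul2r ltn_ord orbT.
by rewrite mulSn addnC ltn_add2r.
Qed.

Definition block lam mu (e : 'I_d) (nu : 'I_(mu e)) : {set 'I_kappa} :=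
  [set triple nu gamma | gamma : 'I_(lam e)].

Definition blocks lam mu (e : 'I_d) : {set {set 'I_kappa}} :=
  [set block lam nu | nu : 'I_(mu e)].

Definition block_perms lam mu : {set 'S_kappa} :=
  [set h : 'S_kappa |
    [forall e, [set h @: B | B : {set 'I_kappa} in blocks lam mu e]
               == blocks lam mu e]].

Lemma group_set_block_perms lam mu : group_set (block_perms lam mu).
Proof.
apply/group_setP; split=> [|s t].
  rewrite inE; apply/forallP => e; apply/eqP.
  rewrite (@eq_imset _ _ _ id) ?imset_id // => B.
  by rewrite (@eq_imset _ _ _ id) ?imset_id // => j; rewrite perm1.
rewrite !inE => /forallP Hs /forallP Ht; apply/forallP => e; apply/eqP.
rewrite -[RHS](eqP (Ht e)) -[in RHS](eqP (Hs e)).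
rewrite -[RHS](imset_comp (fun B : {set 'I_kappa} => t @: B)
                          (fun B : {set 'I_kappa} => s @: B)).
apply: eq_imset => B /=; rewrite -imset_comp.
by apply: eq_imset => j; rewrite permM.
Qed.

Canonical block_perms_group lam mu := Group (group_set_block_perms lam mu).

(* S is a complete set of representatives of the cosets {sigma \o h : h in H},
   with H = block_perms lam mu. Since (h * sigma)%g is sigma \o h in {perm _},
   these are the right cosets H :* sigma. *)
Definition coset_representatives lam mu (S : {set 'S_kappa}) : Prop :=
  is_transversal S (rcosets (block_perms lam mu) [set: 'S_kappa])
    [set: 'S_kappa].

End Blocks.

(* Main.v *)
(* Differentiating f o g repeatedly gives a sum over the set partitions P of
   {1, ..., kappa}: a further derivative either hits the outer factor, which
   adds a singleton block to P, or hits one factor of g, which enlarges one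
   block. Grouping the partitions by the sizes lambda_1 < ... < lambda_d of
   their blocks and the multiplicities mu_e of these sizes gives the formula:
   the symmetric group acts transitively on the partitions of a given type, and
   the stabilizer of the partition into consecutive blocks is the group
   H^{(mu_1,lambda_1),...,(mu_d,lambda_d)}, so the partitions of that type
   correspond to the cosets. The order of differentiation inside a block depends
   on the representative, hence the need for Schwarz's theorem; over C it is
   applied to the real and imaginary parts restricted to real directions. *)
Require Import Defs.
From HB Require Import structures.
From mathcomp Require Import all_boot all_order all_algebra all_fingroup.
From mathcomp Require Import all_classical all_reals all_analysis.
From mathcomp Require Import complex.

Set Implicit Arguments.
Unset Strict Implicit.
Unset Printing Implicit Defensive.

Import Order.TTheory GRing.Theory Num.Theory.
Import numFieldNormedType.Exports.

Local Open Scope ring_scope.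

(** * Symmetry of mixed partial derivatives *)

Section RealSchwarz.
Local Open Scope classical_set_scope.

Lemma mean_value (R : realType) (F dF : R -> R) (a b : R) :
  (forall s, is_derive s (1 : R) F (dF s)) -> a < b ->
  exists2 c, a < c < b & F b - F a = dF c * (b - a).
Proof.
move=> dF' ab.
have cF : {within `[a, b], continuous F}.
  by apply: derivable_within_continuous => s _; case: (dF' s).
have [c] := MVT ab (fun s _ => dF' s) cF.
by rewrite in_itv /= => cab E; exists c.
Qed.

(** Divided by [h ^ 2], the second difference of [G] over a square of side [h] is a value of [G12]
    and also a value of [G21] inside the square; continuity at the origin then forces the two values
    there to agree. *)
Lemma schwarz_real (R : realType) (G G1 G2 G12 G21 : R -> R -> R) :
  (forall s t, is_derive s (1 : R) (G ^~ t) (G1 s t)) ->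
  (forall s t, is_derive t (1 : R) (G s) (G2 s t)) ->
  (forall s t, is_derive t (1 : R) (G1 s) (G12 s t)) ->
  (forall s t, is_derive s (1 : R) (G2 ^~ t) (G21 s t)) ->
  {for (0, 0), continuous (fun p : R * R => G12 p.1 p.2)} ->
  {for (0, 0), continuous (fun p : R * R => G21 p.1 p.2)} ->
  G12 0 0 = G21 0 0.
Proof.
move=> d1 d2 d12 d21 c12 c21.
(* The mean value theorem, applied twice in either order to the second
   difference of G on [0, h] x [0, h]. *)
have second_difference h : 0 < h -> exists s t s' t',
    [/\ 0 < s < h, 0 < t < h, 0 < s' < h, 0 < t' < h &
        G12 s t = G21 s' t'].
  move=> h0.
  have [s sh Es] : exists2 s, 0 < s < h &
      (G h h - G h 0) - (G 0 h - G 0 0) = (G1 s h - G1 s 0) * (h - 0).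
    apply: (@mean_value R (fun s => G s h - G s 0)
      (fun s => G1 s h - G1 s 0)) => //.
  have [t th Et] := mean_value (d12 s) h0.
  have [t' t'h Et'] : exists2 t, 0 < t < h &
      (G h h - G 0 h) - (G h 0 - G 0 0) = (G2 h t - G2 0 t) * (h - 0).
    apply: (@mean_value R (fun t => G h t - G 0 t)
      (fun t => G2 h t - G2 0 t)) => //.
  have [s' s'h Es'] := mean_value (d21^~ t') h0.
  exists s, t, s', t'; split=> //.
  move: Es Et'; rewrite Et Es' !subr0 => Es Et'.
  have hN0 : h != 0 by rewrite gt_eqF.
  apply: (mulIf hN0); apply: (mulIf hN0); rewrite -Es -Et'.
  by rewrite opprB opprB addrACA [- _ - _]addrC addrACA.
(* With half the gap between the two values as tolerance, a value common to [G12] and [G21] near the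
   origin contradicts the triangle inequality. *)
apply/eqP/negPn/negP => neq.
have e0 : 0 < `|G12 0 0 - G21 0 0| / 2.
  by rewrite divr_gt0 ?normr_gt0 ?subr_eq0.
have /cvgrPdist_lt /(_ _ e0) n12 := c12.
have /cvgrPdist_lt /(_ _ e0) n21 := c21.
have /nbhs_ballP[r /= r0 Hr] : nbhs ((0, 0) : R * R)
    ([set p | `|G12 0 0 - G12 p.1 p.2| < `|G12 0 0 - G21 0 0| / 2] `&`
     [set p | `|G21 0 0 - G21 p.1 p.2| < `|G12 0 0 - G21 0 0| / 2]).
  exact: filterI.
have [s [t [s' [t' [sr tr s'r t'r E]]]]] := second_difference r r0.
have inball a b : 0 < a < r -> 0 < b < r -> ball ((0, 0) : R * R) r (a, b).
  move=> /andP[a0 ar] /andP[b0 br].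
  by split; rewrite /ball /= sub0r normrN gtr0_norm.
have [A _] := Hr _ (inball _ _ sr tr).
have [_ B] := Hr _ (inball _ _ s'r t'r).
have := ltrD A B; rewrite /= -splitr E [X in _ + X]distrC => /lt_geF.
by rewrite -[in X in X -> _](subrKA (G21 s' t')) ler_normD.
Qed.
End RealSchwarz.

(** * Reduction of Schwarz's theorem over [K] to real variables *)

Section RealForms.
Local Open Scope classical_set_scope.
Variables (R : realType) (K : numFieldType).
(* For K = R[i], phi is Re or Im; for K = R both maps are the identity. *)
Variables (iota : {rmorphism R -> K}) (phi : K -> R).
Hypothesis iota_lt : forall r s, (iota r < iota s) = (r < s).
Hypothesis iota_norm : forall r, `|iota r| = iota `|r|.
Hypothesis iota_pos : forall e : K, 0 < e -> exists r, e = iota r.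
Hypothesis phi_norm : forall z, iota `|phi z| <= `|z|.
Hypothesis phiB : {morph phi : a b / a - b}.
Hypothesis phiZ : forall r z, phi (iota r * z) = r * phi z.

Lemma iota_continuous : continuous iota.
Proof.
move=> r; apply/cvgrPdist_lt => e e0; have [d dE] := iota_pos e0.
have d0 : 0 < d by rewrite -iota_lt rmorph0 -dE.
have /cvgrPdist_lt /(_ _ d0) := @cvg_id _ (nbhs r).
by apply: filterS => s /= rs; rewrite -rmorphB iota_norm dE iota_lt.
Qed.

Lemma phi_continuous : continuous phi.
Proof.
move=> z; apply/(@cvgrPdist_lt _ _ _ (nbhs z)) => e e0.
have e0K : 0 < iota e by rewrite -(rmorph0 iota) iota_lt.
have /cvgrPdist_lt /(_ _ e0K) := @cvg_id _ (nbhs z).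
apply: filterS => w /= zw; rewrite -iota_lt -phiB.
exact: le_lt_trans (phi_norm _) zw.
Qed.

(** Since [phi] is real linear, the real difference quotient of [phi \o u] along the line is [phi]
    of the [K]-quotient of [u] at the increment [iota h]. The limit passes through because [phi] and
    [iota] are continuous. *)
Lemma is_derive_line (V : normedModType K) (u : V -> K) (v y : V) (s : R) :
  derivable u (iota s *: v + y) v ->
  is_derive s (1 : R) (fun s => phi (u (iota s *: v + y)))
    (phi ('D_v u (iota s *: v + y))).
Proof.
set z := iota s *: v + y => du.
have quotE : (fun h : R => h^-1 *: (((fun s => phi (u (iota s *: v + y)))
      \o shift s) (h *: (1 : R)) - phi (u z))) =
    phi \o (fun k : K => k^-1 *: ((u \o shift z) (k *: v) - u z)) \o iota.
  apply/funext => h /=.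
  rewrite -phiB -[LHS]/(_ * _) -phiZ fmorphV [h *: 1]mulr1 rmorphD scalerDl.
  by rewrite addrA.
have iota0 : iota @ 0^' --> 0^'.
  move=> A A0; have : nbhs (iota 0) (fun y => y != 0 -> A y) by rewrite rmorph0.
  move=> /iota_continuous H.
  apply: (@filterS _ (nbhs (0 : R)) _ _ _ _ H) => h Ah h0.
  by apply: Ah; rewrite fmorph_eq0.
have cv : (fun h : R => h^-1 *: (((fun s => phi (u (iota s *: v + y)))
      \o shift s) (h *: (1 : R)) - phi (u z))) @ 0^' --> phi ('D_v u z).
  have cQ : (fun k : K => k^-1 *: ((u \o shift z) (k *: v) - u z)) @ 0^' -->
      'D_v u z by exact: du.
  rewrite quotE.
  exact: (cvg_comp _ _ iota0 (cvg_comp _ _ cQ (@phi_continuous _))).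
by split; [apply/cvg_ex; eexists; exact: cv | exact: cvg_lim cv].
Qed.

(** This is [schwarz_real] for [phi \o u] restricted to the points [x + s v + t w] with [s] and [t]
    real. *)
Lemma schwarz_form (V : normedModType K) (u : V -> K) (v w x : V) :
  (forall y, derivable u y v) -> (forall y, derivable u y w) ->
  (forall y, derivable ('D_v u) y w) -> (forall y, derivable ('D_w u) y v) ->
  continuous ('D_w ('D_v u)) -> continuous ('D_v ('D_w u)) ->
  phi ('D_w ('D_v u) x) = phi ('D_v ('D_w u) x).
Proof.
move=> dv dw dvw dwv cvw cwv.
pose p (s t : R) : V := iota s *: v + (iota t *: w + x).
(* [is_derive_line] wants the moving term in front, so the point is also written with its [t] term
   first. *)
have pC s t : p s t = iota t *: w + (iota s *: v + x) by rewrite addrCA.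
have cp A : continuous A ->
    {for (0, 0), continuous (fun q : R * R => phi (A (p q.1 q.2)))}.
  move=> cA; apply: (continuous_comp (f := fun q : R * R => p q.1 q.2)
    (g := phi \o A)); last first.
    exact: (cvg_comp _ _ (@cA _) (@phi_continuous _)).
  apply: cvgD.
    apply: cvgZr_tmp; apply: (cvg_comp _ _ cvg_fst); exact: iota_continuous.
  apply: cvgD; last exact: cvg_cst.
  by apply: cvgZr_tmp; apply: (cvg_comp _ _ cvg_snd); exact: iota_continuous.
have p00 : p 0 0 = x by rewrite /p rmorph0 !scale0r !add0r.
rewrite -p00.
apply: (@schwarz_real R (fun s t => phi (u (p s t)))
  (fun s t => phi ('D_v u (p s t))) (fun s t => phi ('D_w u (p s t)))
  (fun s t => phi ('D_w ('D_v u) (p s t)))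
  (fun s t => phi ('D_v ('D_w u) (p s t)))).
- by move=> s t; exact: is_derive_line.
- move=> s t; rewrite pC.
  rewrite [X in is_derive _ _ X](_ : _ = fun t =>
     phi (u (iota t *: w + (iota s *: v + x)))); last first.
    by apply/funext => t'; rewrite pC.
  exact: is_derive_line.
- move=> s t; rewrite pC.
  rewrite [X in is_derive _ _ X](_ : _ = fun t =>
     phi ('D_v u (iota t *: w + (iota s *: v + x)))); last first.
    by apply/funext => t'; rewrite pC.
  exact: is_derive_line.
- by move=> s t; exact: is_derive_line.
- exact: (cp _ cvw).
- exact: (cp _ cwv).
Qed.
End RealForms.

Section Schwarz.
Local Open Scope classical_set_scope.

Lemma normc_real (R : rcfType) (r : R) : `|r%:C%C| = `|r|%:C%C.
Proof. by rewrite normc_def /= expr0n addr0 sqrtr_sqr. Qed.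

Lemma posc_real (R : rcfType) (e : R[i]) : 0 < e -> exists r : R, e = r%:C%C.
Proof.
by move=> e0; exists (complex.Re e); rewrite RRe_real // gtr0_real.
Qed.

Lemma schwarz_complex (R : realType) (K := R[i] : numFieldType)
    (V : normedModType K) (u : V -> K) (v w x : V) :
  (forall y, derivable u y v) -> (forall y, derivable u y w) ->
  (forall y, derivable ('D_v u) y w) -> (forall y, derivable ('D_w u) y v) ->
  continuous ('D_w ('D_v u)) -> continuous ('D_v ('D_w u)) ->
  'D_w ('D_v u) x = 'D_v ('D_w u) x.
Proof.
pose iota : {rmorphism R -> K} := real_complex R.
pose re (z : K) : R := complex.Re (z : R[i]).
pose im (z : K) : R := complex.Im (z : R[i]).
have iota_lt r s : (iota r < iota s) = (r < s) by exact: ltcR.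
have iota_norm r : `|iota r| = iota `|r| by exact: normc_real.
have iota_pos (e : K) : 0 < e -> exists r, e = iota r by exact: posc_real.
have re_norm z : iota `|re z| <= `|z| by exact: normc_ge_Re.
(* The imaginary part of [z] is minus the real part of [z * 'i%C], and ['i%C] has norm 1. *)
have im_norm z : iota `|im z| <= `|z|.
  have normi : `|'i%C| = 1 :> R[i].
    by rewrite normc_def /= expr0n expr1n add0r sqrtr1.
  have := normc_ge_Re ((z : R[i]) * 'i%C).
  by rewrite ReiNIm normrN normrM normi mulr1.
have reB : {morph re : a b / a - b} by move=> a b; exact: (raddfB (@complex.Re R)).
have imB : {morph im : a b / a - b} by move=> a b; exact: (raddfB (@complex.Im R)).
have reZ r z : re (iota r * z) = r * re z.
  by case: z => a b; rewrite /re /= mul0r subr0.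
have imZ r z : im (iota r * z) = r * im z.
  by case: z => a b; rewrite /im /= mul0r addr0.
have complex_ext (z z' : K) : re z = re z' -> im z = im z' -> z = z'.
  by case: z => a b; case: z' => a' b'; rewrite /re /im /= => -> ->.
move=> dv dw dvw dwv cvw cwv.
have E1 := schwarz_form iota_lt iota_norm iota_pos re_norm reB reZ
  x dv dw dvw dwv cvw cwv.
have E2 := schwarz_form iota_lt iota_norm iota_pos im_norm imB imZ
  x dv dw dvw dwv cvw cwv.
exact: complex_ext E1 E2.
Qed.

Lemma schwarz (R : realType) (K : numFieldType) (V : normedModType K)
    (u : V -> K) (v w x : V) :
  K = R \/ K = R[i] ->
  (forall y, derivable u y v) -> (forall y, derivable u y w) ->
  (forall y, derivable ('D_v u) y w) -> (forall y, derivable ('D_w u) y v) ->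
  continuous ('D_w ('D_v u)) -> continuous ('D_v ('D_w u)) ->
  'D_w ('D_v u) x = 'D_v ('D_w u) x.
Proof.
case=> KE; subst K; last exact: schwarz_complex.
move=> dv dw dvw dwv cvw cwv.
apply: (@schwarz_form R R idfun id) => //.
by move=> e _; exists e.
Qed.

End Schwarz.

(** By [schwarz] two adjacent indices can be exchanged, so the head of [s1] can be brought to the
    front of [s2]; induction handles the tails. *)
Lemma partials_perm (R : realType) (K : numFieldType)
    (KE : K = R \/ K = R[i]) (n : nat) (g : 'rV[K]_n -> K) (s1 s2 : seq 'I_n) :
  smooth g -> perm_eq s1 s2 -> partials s1 g = partials s2 g.
Proof.
move=> gs; elim: s1 s2 => [|a s1 IH] s2 E.
  by move: E; rewrite perm_sym => /perm_nilP ->.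
have swap b c s : partials [:: b, c & s] g = partials [:: c, b & s] g.
  apply/funext => x; symmetry; apply: (schwarz x KE) => //.
  - by move=> y; case: (gs s).
  - by move=> y; case: (gs s).
  - by move=> y; case: (gs (b :: s)).
  - by move=> y; case: (gs (c :: s)).
  - by case: (gs [:: c, b & s]).
  - by case: (gs [:: b, c & s]).
have front s t : partials (s ++ a :: t) g = partials (a :: s ++ t) g.
  by elim: s => //= b s IHs; rewrite [partials (s ++ _) g]IHs; exact: swap.
have : a \in s2 by rewrite -(perm_mem E) mem_head.
move=> as2; case/splitPr: as2 E => p q E.
rewrite front /= (IH (p ++ q)) //.
by move: E; rewrite perm_sym perm_catC /= perm_cons perm_catC perm_sym.
Qed.

(** * Sums over set partitions *)

Section PartitionRecursion.
Import boot.fintype boot.finset.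
Variables (T : finType) (a : T) (A : {set T}).
Hypothesis aA : a \notin A.
Implicit Types (B X : {set T}) (P Q : {set {set T}}).

Lemma block_notin P B : partition P A -> B \in P -> a \notin B.
Proof.
move=> partP BP; apply: contra aA; apply/subsetP.
exact: partitionS partP BP.
Qed.

Lemma set1_notin_partition P : partition P A -> [set a] \notin P.
Proof.
by move=> partP; apply/negP => /(block_notin partP); rewrite !inE eqxx.
Qed.

Lemma setU1_notin_partition P B : partition P A -> a |: B \notin P.
Proof.
by move=> partP; apply/negP => /(block_notin partP); rewrite !inE eqxx.
Qed.

Lemma partition_singleton P :
  partition P A -> partition ([set a] |: P) (a |: A).
Proof.
move=> partP; apply: partitionU1 => //; last by rewrite disjoints1.
by apply/set0Pn; exists a; rewrite inE.
Qed.

Definition extend_block P B := (a |: B) |: (P :\ B).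

Lemma partition_extend_block P B :
  partition P A -> B \in P -> partition (extend_block P B) (a |: A).
Proof.
move=> partP BP.
have -> : a |: A = (a |: B) :|: (A :\: B).
  rewrite -setUA -[in LHS](setID A B) (setIidPr _) //.
  exact: partitionS partP BP.
apply: partitionU1; first exact: partitionD1.
  by apply/set0Pn; exists a; rewrite !inE eqxx.
rewrite -setI_eq0; apply/eqP/setP => y; rewrite !inE.
by case: eqP => [->|_] /=; [rewrite (negPf aA) andbF | case: (y \in B)].
Qed.

Lemma set1_notin_extend_block P B :
  partition P A -> B \in P -> [set a] \notin extend_block P B.
Proof.
move=> partP BP; rewrite !inE negb_or negb_and set1_notin_partition // orbT.
rewrite andbT; apply/eqP => /setP E.
have /set0Pn[b bB] := partition_neq0 partP BP.
have := E b; rewrite !inE bB orbT => /eqP ba.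
by have := block_notin partP BP; rewrite -ba bB.
Qed.

Lemma pblock_extend_block P B :
  partition P A -> B \in P -> pblock (extend_block P B) a = a |: B.
Proof.
move=> partP BP; apply: def_pblock; rewrite ?inE ?eqxx //.
exact: partition_trivIset (partition_extend_block partP BP).
Qed.

(** Inverse of [extend_block] on the partitions where [a] is not alone: the partition with [a]
    deleted, paired with the block that lost it. *)
Definition shrink_block Q :=
  ((pblock Q a :\ a) |: (Q :\ pblock Q a), pblock Q a :\ a).

Lemma extend_blockK P B :
  partition P A -> B \in P -> shrink_block (extend_block P B) = (P, B).
Proof.
move=> partP BP; rewrite /shrink_block pblock_extend_block //.
have -> : (a |: B) :\ a = B by rewrite setU1K ?(block_notin partP BP).
rewrite /extend_block setU1K; first by rewrite setD1K.
by rewrite !inE negb_and setU1_notin_partition ?orbT.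
Qed.

Lemma shrink_blockP Q : partition Q (a |: A) -> [set a] \notin Q ->
  [/\ partition (shrink_block Q).1 A, (shrink_block Q).2 \in (shrink_block Q).1
    & extend_block (shrink_block Q).1 (shrink_block Q).2 = Q].
Proof.
move=> partQ aQ /=; set X := pblock Q a.
have acov : a \in cover Q by rewrite (cover_partition partQ) !inE eqxx.
have aX : a \in X by rewrite mem_pblock.
have XQ : X \in Q by apply: pblock_mem.
have XaE : a |: (X :\ a) = X by rewrite setD1K.
have Xa0 : X :\ a != set0.
  apply: contraNneq aQ => Xa0; suff <- : X = [set a] by [].
  by rewrite -XaE Xa0 setU0.
have XA : X \subset a |: A := partitionS partQ XQ.
have partD := partitionD1 partQ XQ.
split; last 1 first.
(* [X :\ a] is nonempty and inside [X], so it cannot be one of the blocks left after removing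
   [X]. *)
- rewrite /extend_block XaE setU1K ?setD1K //.
  apply/negP => /(partitionS partD) /subsetP H.
  have /set0Pn[b] := Xa0 => bX; have := H _ bX.
  by move: bX; rewrite !inE => /andP[_ ->].
- have AE : A = (X :\ a) :|: ((a |: A) :\: X).
    apply/setP => y; rewrite !inE.
    have := subsetP XA y; rewrite !inE.
    case: eqP => [->|_] /=; first by rewrite aX (negPf aA).
    by case: (y \in X) => /=; [move=> ->|].
  rewrite [X in partition _ X]AE; apply: partitionU1 => //.
  rewrite -setI_eq0; apply/eqP/setP => y; rewrite !inE.
  by case: (y \in X); rewrite ?andbF.
- by rewrite !inE eqxx.
Qed.

(** Either [[set a]] is a block, and deleting it leaves a partition of [A], or [shrink_block]
    matches the partition with a pair [(P, B)], [B] being the block to enlarge. *)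
Lemma big_partition_setU1 (R : nmodType) (F : {set {set T}} -> R) :
  \sum_(P : {set {set T}} | partition P (a |: A)) F P =
  \sum_(P : {set {set T}} | partition P A)
    (F ([set a] |: P) + \sum_(B in P) F (extend_block P B)).
Proof.
rewrite big_split /= (bigID (fun P : {set {set T}} => [set a] \in P)) /=.
congr (_ + _).
  rewrite (reindex_onto (fun P => [set a] |: P) (fun P => P :\ [set a])) /=;
    last first.
    by move=> P /andP[_ aP]; rewrite setD1K.
  apply: eq_bigl => P; rewrite !inE eqxx andbT;
  apply/andP/idP => [[partQ /eqP E]|partP].
    have := partitionD1 partQ (setU11 _ _).
    by rewrite E setU1K.
  rewrite setU1K ?set1_notin_partition // eqxx.
  by split; first exact: partition_singleton.
rewrite pair_big_dep /=.
rewrite (reindex_onto (fun p => extend_block p.1 p.2) shrink_block) /=;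
  last first.
  by move=> Q /andP[partQ aQ]; case: (shrink_blockP partQ aQ).
apply: eq_bigl => -[P B] /=;
apply/andP/andP => [[/andP[partQ aQ] /eqP E]|[partP BP]].
  by have [] := shrink_blockP partQ aQ; rewrite E /=.
by rewrite extend_blockK // partition_extend_block // set1_notin_extend_block.
Qed.

End PartitionRecursion.

(** * Derivatives of a composition *)

Section Derivatives.
Variables (K : numFieldType) (V : normedModType K).

Lemma derive_line (u : V -> K) (x v : V) :
  'D_v u x = derive1 (fun h : K => u (h *: v + x)) 0.
Proof.
rewrite derive1E /derive; set q1 := fun h => h^-1 *: _.
set q2 := fun h => h^-1 *: _; suff -> : q1 = q2 by [].
by apply/funext => h; rewrite /q1 /q2 /= addr0 scale0r add0r [_%:A]mulr1.
Qed.

(** Along the line through [x] with direction [v] both maps have one variable, where derivability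
    amounts to differentiability and the chain rule for differentials applies. *)
Lemma is_derive_chain (u : V -> K) (f : K -> K) (x v : V) :
  derivable u x v -> derivable f (u x) 1 ->
  is_derive x v (f \o u) (derive1 f (u x) * 'D_v u x).
Proof.
move=> du df.
have du' : differentiable (fun h : K => u (h *: v + x)) (0 : K).
  exact: ((derivable1_diffP _ _).1 ((derivable1P u x v).1 du)).
have df' : differentiable f (u ((0 : K) *: v + x)).
  by apply/derivable1_diffP; rewrite scale0r add0r.
split.
  apply/(derivable1P (f \o u)); apply/derivable1_diffP.
  exact: (differentiable_comp du' df').
have fx0 : u ((0 : K) *: v + x) = u x by rewrite scale0r add0r.
have D := diff_comp du' df'.
rewrite !derive_line derive1E'; last exact: (differentiable_comp du' df').
have Df h : 'd f (u ((0 : K) *: v + x)) h = h *: derive1 f (u x).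
  by rewrite (diff1E df') fx0.
have Du h : 'd (fun h : K => u (h *: v + x)) (0 : K) h =
    h *: derive1 (fun h : K => u (h *: v + x)) 0 by rewrite (diff1E du').
transitivity ('d f (u ((0 : K) *: v + x))
  ('d (fun h : K => u (h *: v + x)) (0 : K) 1));
  first exact: (congr1 (fun F : K -> K => F 1) D).
by rewrite Df Du scale1r mulrC.
Qed.

Lemma is_derive_prod (I : eqType) (r : seq I) (F : I -> V -> K)
    (dF : I -> K) (x v : V) :
  uniq r -> (forall i, i \in r -> is_derive x v (F i) (dF i)) ->
  is_derive x v (fun y => \prod_(i <- r) F i y)
    (\sum_(i <- r) dF i * \prod_(j <- r | j != i) F j x).
Proof.
elim: r => [|a r IH] /= => [_ _|/andP[ar ur] dFr].
  rewrite big_nil [X in is_derive _ _ X](_ : _ = cst 1).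
    exact: is_derive_cst.
  by apply/funext => y; rewrite big_nil.
have dFa := dFr a (mem_head _ _).
have dFr' := IH ur (fun i ir => dFr i (mem_behead (s := a :: r) ir)).
have := @is_deriveM _ _ _ _ _ _ _ _ dFa dFr'.
have -> : F a * (fun y => \prod_(i <- r) F i y) =
    (fun y => \prod_(i <- a :: r) F i y).
  by apply/funext => y; rewrite big_cons.
move=> H; apply: is_derive_eq H _.
rewrite [RHS]big_cons big_cons eqxx /= addrC; congr (_ + _).
  (* [a] does not occur in [r], so the condition [j != a] removes nothing. *)
  rewrite [LHS]mulrC; congr (_ * _); rewrite [RHS]big_seq_cond [LHS]big_seq_cond.
  apply: eq_bigl => i; rewrite andbT; case: (boolP (i \in r)) => //= ir.
  by rewrite (memPn ar).
rewrite -[LHS]/(_ * _) mulr_sumr [LHS]big_seq_cond [RHS]big_seq_cond.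
apply: eq_bigr => i /andP[ir _].
rewrite big_cons eq_sym (memPn ar) // mulrCA //.
Qed.

End Derivatives.

(** * Derivatives of [f \o g] as sums over set partitions *)

Section FaaDiBrunoPartitions.
Import boot.fintype boot.finset.

Lemma is_derive_bigsum (K : numFieldType) (V : normedModType K) (I : Type)
    (r : seq I) (P : pred I) (F : I -> V -> K) (dF : I -> K) (x v : V) :
  (forall i, P i -> is_derive x v (F i) (dF i)) ->
  is_derive x v (fun y => \sum_(i <- r | P i) F i y) (\sum_(i <- r | P i) dF i).
Proof.
move=> dFP; have -> : (fun y => \sum_(i <- r | P i) F i y) =
    \sum_(i <- r | P i) F i.
  by apply/funext => y; rewrite fct_sumE.
by elim/big_ind2: _ => // *; [exact: is_derive_cst | exact: is_deriveD].
Qed.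

Variables (K : numFieldType) (n : nat) (g : 'rV[K]_n -> K) (f : K -> K).
Variables (I : finType) (i : I -> 'I_n).
Hypothesis g_smooth : smooth g.
Hypothesis f_smooth : smooth1 f.
Hypothesis partials_g_perm :
  forall s1 s2, perm_eq s1 s2 -> partials s1 g = partials s2 g.

(** The order of differentiation is that of [enum B]; by [partials_g_perm] any other listing of the
    block gives the same derivative. *)
Definition block_partial (B : {set I}) := partials [seq i j | j <- enum B] g.

Definition partition_term (P : {set {set I}}) (x : 'rV[K]_n) :=
  derive1n #|P| f (g x) * \prod_(B in P) block_partial B x.

Lemma is_derive_block_partial (a : I) (B : {set I}) x : a \notin B ->
  is_derive x 'e_(i a) (block_partial B) (block_partial (a |: B) x).
Proof.
move=> aB; have -> : block_partial (a |: B) = 'D_('e_(i a)) (block_partial B).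
  rewrite -[RHS]/(partials (i a :: [seq i j | j <- enum B]) g).
  (* [a] need not come first in [enum (a |: B)], hence the appeal to symmetry. *)
  apply: partials_g_perm; rewrite -map_cons; apply: perm_map.
  apply: uniq_perm; rewrite /= ?enum_uniq ?mem_enum ?aB // => y.
  by rewrite inE !mem_enum !inE.
by apply: derivableP; have [_] := g_smooth [seq i j | j <- enum B]; apply.
Qed.

(** The chain rule on the [f] factor raises its order by one and adds the block [[set a]]; the
    product rule on the factors of [g] enlarges one block and keeps the number of blocks. *)
Lemma is_derive_partition_term (a : I) (A : {set I}) (P : {set {set I}}) x :
  a \notin A -> partition P A ->
  is_derive x 'e_(i a) (partition_term P)
    (partition_term ([set a] |: P) x +
     \sum_(B in P) partition_term (extend_block a P B) x).
Proof.
move=> aA partP.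
have dprod : is_derive x 'e_(i a) (fun y => \prod_(B in P) block_partial B y)
    (\sum_(B in P) block_partial (a |: B) x *
       \prod_(C in P | C != B) block_partial C x).
  have := @is_derive_prod K _ _ (enum P) block_partial
    (fun B => block_partial (a |: B) x) x 'e_(i a) (enum_uniq _).
  rewrite big_enum /=.
  under eq_bigr do rewrite big_enum_cond /=.
  have -> : (fun y => \prod_(B <- enum P) block_partial B y) =
      (fun y => \prod_(B in P) block_partial B y).
    by apply/funext => y; rewrite big_enum.
  apply=> B; rewrite mem_enum => BP.
  exact: is_derive_block_partial (block_notin aA partP BP).
have dfg : is_derive x 'e_(i a) (derive1n #|P| f \o g)
    (derive1n #|P|.+1 f (g x) * block_partial [set a] x).
  rewrite derive1nS /block_partial enum_set1 /=.
  apply: is_derive_chain; first by have [_] := g_smooth [::]; apply.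
  by have [_] := f_smooth #|P|; apply.
have := is_deriveM dfg dprod.
move=> H; apply: is_derive_eq H _; rewrite addrC; congr (_ + _).
  rewrite /partition_term cardsU1 big_setU1 (set1_notin_partition aA partP) //=.
  by rewrite -[LHS]/(_ * _) mulrC -mulrA.
rewrite -[LHS]/(_ * _) mulr_sumr; apply: eq_bigr => B BP.
have aBP : a |: B \notin P :\ B.
  by rewrite !inE negb_and (setU1_notin_partition aA B partP) orbT.
have cardP : #|extend_block a P B| = #|P|.
  by rewrite cardsU1 aBP [RHS](cardsD1 B) BP.
rewrite /partition_term cardP big_setU1 //=.
congr (_ * (_ * _)); apply: eq_bigl => C.
by rewrite !inE andbC.
Qed.

(** Induction on [s]: [partials] differentiates along the head last, so the head is the new element
    in [big_partition_setU1]. *)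
Lemma faa_di_bruno_partitions (s : seq I) : uniq s ->
  partials [seq i j | j <- s] (f \o g) =
  (fun x => \sum_(P : {set {set I}} | partition P [set j in s])
              partition_term P x).
Proof.
elim: s => [_|a s IH /= /andP[as_ us]].
  apply/funext => x /=.
  (* The empty set has only the empty partition, whose term is [f \o g] itself. *)
  rewrite (big_pred1 set0); last first.
    by move=> P; rewrite set_nil partition_set0.
  by rewrite /partition_term cards0 big_set0 mulr1.
rewrite IH //; apply/funext => x.
have aA : a \notin [set j in s] by rewrite inE.
rewrite set_cons (big_partition_setU1 aA (fun P => partition_term P x)).
apply: derive_val.
by apply: is_derive_bigsum => P partP; apply: is_derive_partition_term partP.
Qed.

End FaaDiBrunoPartitions.

(** * Types of partitions and cosets *)

Section PermPartition.
Import boot.fintype boot.finset.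
Variable T : finType.
Implicit Types (P Q : {set {set T}}) (s t : {perm T}).

Definition perm_partition s P : {set {set T}} :=
  [set [set s x | x in B] | B : {set T} in P].

(** In [{perm T}] the product [s * t] applies [s] first, so this is a right action. *)
Lemma perm_partitionM s t P :
  perm_partition (s * t)%g P = perm_partition t (perm_partition s P).
Proof.
rewrite /perm_partition -[RHS](imset_comp (fun B : {set T} => t @: B)
  (fun B : {set T} => s @: B)).
apply: eq_imset => B /=; rewrite -imset_comp.
by apply: eq_imset => x; rewrite permM.
Qed.

Lemma perm_partition1 P : perm_partition 1%g P = P.
Proof.
rewrite /perm_partition (@eq_imset _ _ _ id) ?imset_id // => B.
by rewrite (@eq_imset _ _ _ id) ?imset_id // => x; rewrite perm1.
Qed.

(** As a function of [k] this encodes the type of [P] without reference to [d]: it is [mu e] at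
    [lam e] and 0 elsewhere. *)
Definition size_count P (k : nat) : nat := #|[set B in P | #|B| == k]|.

Lemma size_count_perm s P k : size_count (perm_partition s P) k = size_count P k.
Proof.
have inj : injective (fun B : {set T} => s @: B) := imset_inj (@perm_inj T s).
rewrite /size_count -(card_imset [set B in P | #|B| == k] inj).
apply: eq_card => B; rewrite inE; apply/andP/imsetP.
  move=> [/imsetP[C CP ->]]; rewrite card_imset; last exact: perm_inj.
  by move=> Ck; exists C => //; rewrite inE CP.
move=> [C]; rewrite inE => /andP[CP Ck] ->.
by rewrite imset_f // card_imset //; exact: perm_inj.
Qed.

Lemma partition_perm s P : partition (perm_partition s P) setT = partition P setT.
Proof.
rewrite -(imset_partition P setT (@perm_inj T s)); congr (partition _ _).
apply/setP => x; rewrite inE; symmetry; apply/imsetP.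
by exists (s^-1%g x); rewrite ?permKV ?inE.
Qed.

Lemma perm_eq_block_sizes P Q :
  (forall k, size_count P k = size_count Q k) ->
  perm_eq [seq #|B| | B : {set T} <- enum P] [seq #|B| | B : {set T} <- enum Q].
Proof.
have countE (R : {set {set T}}) k :
    count_mem k [seq #|B| | B : {set T} <- enum R] = size_count R k.
  rewrite count_map -size_filter /size_count cardE; congr size.
  rewrite {1}/enum_mem -filter_predI; apply: eq_filter => B.
  by rewrite /= !inE andbC.
move=> E; apply/allP => k _ /=; apply/eqP.
by rewrite !countE.
Qed.

Definition sorted_blocks P : seq {set T} :=
  sort (fun B C : {set T} => #|B| <= #|C|)%N (enum P).

(** Partitions of the same type have listings cut into pieces of the same lengths, so matching
    positions carries blocks to blocks. *)
Definition listing P : seq T :=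
  flatten [seq enum B | B : {set T} <- sorted_blocks P].

Lemma mem_sorted_blocks P B : (B \in sorted_blocks P) = (B \in P).
Proof. by rewrite mem_sort mem_enum. Qed.

Lemma perm_listing P : partition P setT -> perm_eq (listing P) (enum T).
Proof.
move=> partP; have mem_listing : listing P =i enum T.
  move=> x; rewrite mem_enum inE; apply/flatten_mapP.
  have xP : x \in cover P by rewrite (cover_partition partP) inE.
  exists (pblock P x); first by rewrite mem_sorted_blocks pblock_mem.
  by rewrite mem_enum mem_pblock.
apply: uniq_perm; rewrite ?enum_uniq //.
(* Absence of repetitions follows by counting: the length of the listing is the sum of the block
   sizes, hence the cardinality of [T]. *)
rewrite (uniq_size_uniq (enum_uniq T) (fun x => esym (mem_listing x))).
rewrite -cardE -cardsT (card_partition partP) size_flatten /shape -map_comp.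
rewrite sumnE big_map (perm_big (enum P)) ?perm_sort //= big_enum /=.
by apply/eqP; apply: eq_bigr => B _; rewrite -cardE.
Qed.

Lemma sorted_blocks_sizes P Q :
  (forall k, size_count P k = size_count Q k) ->
  [seq #|B| | B : {set T} <- sorted_blocks P] =
  [seq #|B| | B : {set T} <- sorted_blocks Q].
Proof.
move=> E; apply: (sorted_eq leq_trans anti_leq).
- rewrite sorted_map; apply: sort_sorted => B C; exact: leq_total.
- rewrite sorted_map; apply: sort_sorted => B C; exact: leq_total.
apply: (perm_trans (y := [seq #|B| | B : {set T} <- enum P])).
  by apply: perm_map; rewrite perm_sort.
apply: perm_trans (perm_eq_block_sizes E) _.
by apply: perm_map; rewrite perm_sym perm_sort.
Qed.

Lemma perm_partition_transitive P Q :
  partition P setT -> partition Q setT ->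
  (forall k, size_count P k = size_count Q k) ->
  exists s, Q = perm_partition s P.
Proof.
move=> partP partQ E.
have permP := perm_listing partP; have permQ := perm_listing partQ.
have sizeE : size (listing P) = size (listing Q).
  by rewrite (perm_size permP) (perm_size permQ).
have uniqP : uniq (listing P) by rewrite (perm_uniq permP) enum_uniq.
have uniqQ : uniq (listing Q) by rewrite (perm_uniq permQ) enum_uniq.
have memP x : x \in listing P by rewrite (perm_mem permP) mem_enum.
(* f matches the elements of P and Q listed block after block, in the order of
   increasing block sizes. *)
pose f x := nth x (listing Q) (index x (listing P)).
have f_inj : injective f.
  (* The indices are in range, so both values of [f] may use the same default. *)
  move=> x y; rewrite /f (set_nth_default x y); last by rewrite -sizeE index_mem.
  move=> /eqP; rewrite nth_uniq -?sizeE ?index_mem // => /eqP.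
  by move=> ixy; rewrite -(nth_index x (memP x)) ixy nth_index.
have map_listing : map f (listing P) = listing Q.
  case: (listing P =P [::]) => [P0|].
    by move: sizeE; rewrite P0 /= => /esym/size0nil ->.
  case LP : (listing P) => [//|x0 l] _; rewrite -LP.
  apply: (@eq_from_nth _ x0); rewrite size_map // => j jP.
  rewrite (nth_map x0) // /f index_uniq //; apply: set_nth_default.
  by rewrite -sizeE.
exists (perm f_inj).
(* The flattened lists agree and so do the lengths of the pieces; hence the pieces agree one by
   one. *)
have blocksE : map (map f) [seq enum B | B : {set T} <- sorted_blocks P] =
    [seq enum B | B : {set T} <- sorted_blocks Q].
  apply: eq_from_flatten_shape; first by rewrite -map_flatten.
  rewrite /shape -!map_comp.
  transitivity [seq #|B| | B : {set T} <- sorted_blocks P].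
    by apply: eq_map => B /=; rewrite size_map -cardE.
  by rewrite (sorted_blocks_sizes E); apply: eq_map => B /=; exact: cardE.
have imE : [seq perm f_inj @: B | B : {set T} <- sorted_blocks P] = sorted_blocks Q.
  have := congr1 (map (fun l => [set x in l])) blocksE.
  rewrite -!map_comp => E'.
  transitivity [seq [set x in enum B] | B : {set T} <- sorted_blocks Q].
    rewrite -[RHS]E'; apply: eq_map => B /=; apply/setP => y; rewrite [RHS]inE.
    apply/imsetP/mapP => [[x xB ->]|[x xB ->]]; exists x; rewrite ?permE //.
      by rewrite mem_enum.
    by rewrite -mem_enum.
  rewrite -[RHS]map_id; apply: eq_map => B; apply/setP => y.
  by rewrite inE mem_enum.
apply/setP => B; rewrite -mem_sorted_blocks -imE.
apply/mapP/imsetP => [[C CP ->]|[C CP ->]]; exists C => //.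
  by rewrite -mem_sorted_blocks.
by rewrite mem_sorted_blocks.
Qed.

End PermPartition.

(** * The partition into consecutive blocks, its stabilizer and its orbit *)

Section BasePartition.
Import boot.fintype boot.finset.
Variables (kappa d : nat).
Hypothesis kappa_gt0 : (0 < kappa)%N.
Variables lam mu : {ffun 'I_d -> 'I_kappa.+1}.
Hypothesis lam_increasing : increasing lam.
Hypothesis lam_mu : multiplicities lam mu.

Local Notation T := 'I_kappa.
Local Notation block_index := {e : 'I_d & 'I_(mu e)}.
Local Notation triple := (triple kappa_gt0).
Implicit Types (e : 'I_d) (p : block_index) (P : {set {set T}}).

Lemma lam_gt0 e : (0 < lam e)%N.
Proof. by case/andP: lam_increasing => /forallP. Qed.

Lemma lam_lt e e' : (e < e')%N -> (lam e < lam e')%N.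
Proof. by case/andP: lam_increasing => _ /forallP/(_ e)/forallP/(_ e')/implyP. Qed.

Lemma lam_inj : injective (fun e => lam e : nat).
Proof.
move=> e e' E; apply/val_inj/eqP => /=.
by case: ltngtP => // /lam_lt; rewrite E ltnn.
Qed.

(** The ranks belonging to [e] end before the partial sum that includes [mu e * lam e], and this sum
    is at most the first rank belonging to [e']. *)
Lemma triple_rank_lt e (nu : 'I_(mu e)) (gamma : 'I_(lam e)) e'
    (nu' : 'I_(mu e')) (gamma' : 'I_(lam e')) :
  (e < e')%N -> (triple_rank nu gamma < triple_rank nu' gamma')%N.
Proof.
move=> ee'; rewrite /triple_rank.
apply: (@leq_trans (\sum_(e'' < d | e'' < e) mu e'' * lam e'' + mu e * lam e)%N).
  rewrite -addnA ltn_add2l.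
  apply: (@leq_trans (nu.+1 * lam e)); last by rewrite leq_mul2r ltn_ord orbT.
  by rewrite mulSn addnC ltn_add2r.
rewrite -addnA; apply: leq_trans (leq_addr _ _).
rewrite [leqRHS](bigID (fun e'' : 'I_d => (e'' < e)%N)) /=; apply: leq_add.
  rewrite [leqRHS](eq_bigl (fun e'' : 'I_d => (e'' < e)%N)) // => e''.
  by apply/andb_idl => lt; exact: ltn_trans lt ee'.
by rewrite (bigD1 e) /= ?ltnn ?ee' // leq_addr.
Qed.

(** The rank determines [e] by [triple_rank_lt]; then [nu] is a quotient by [lam e] and [gamma] the
    remainder. The last equality is in [nat] because the types of [gamma] and [gamma'] depend on [p]
    and [p']. *)
Lemma triple_inj (p p' : block_index) (gamma : 'I_(lam (tag p)))
    (gamma' : 'I_(lam (tag p'))) :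
  triple (tagged p) gamma = triple (tagged p') gamma' ->
  p = p' /\ gamma = gamma' :> nat.
Proof.
move=> /(congr1 val) /=; rewrite !val_triple //.
case: p p' gamma gamma' => [e nu] [e' nu'] /= gamma gamma' E.
have ee' : e = e'.
  apply/val_inj/eqP => /=; case: (ltngtP e e') => // lt.
    by have := triple_rank_lt nu gamma nu' gamma' lt; rewrite E ltnn.
  by have := triple_rank_lt nu' gamma' nu gamma lt; rewrite E ltnn.
case: e' / ee' nu' gamma' E => nu' gamma'; rewrite /triple_rank -!addnA.
move/addnI => E; have nuE : nu = nu' :> nat.
  have := congr1 (divn^~ (lam e)) E.
  by rewrite !divnMDl ?lam_gt0 // !divn_small ?addn0.
split; last by apply/eqP; rewrite -(eqn_add2l (nu * lam e)) E nuE.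
by rewrite (val_inj nuE).
Qed.

Definition index_block p : {set T} := block kappa_gt0 lam (tagged p).

Definition base_partition : {set {set T}} := [set index_block p | p : block_index].

Lemma card_index_block p : #|index_block p| = lam (tag p).
Proof.
rewrite /index_block /block card_imset ?card_ord // => gamma gamma' E.
exact: (val_inj (triple_inj E).2).
Qed.

Lemma index_block_disjoint p p' :
  p' != p -> [disjoint index_block p & index_block p'].
Proof.
move=> pp'; rewrite -setI_eq0; apply: contraR pp' => /set0Pn[x].
rewrite inE => /andP[/imsetP[gamma _ ->] /imsetP[gamma' _ E]].
by rewrite (triple_inj E).1.
Qed.

Lemma index_block_neq0 p : index_block p != set0.
Proof. by rewrite -card_gt0 card_index_block lam_gt0. Qed.

Lemma index_block_inj : injective index_block.
Proof.
move=> p p' E; apply/eqP; apply: contraNT (index_block_neq0 p') => pp'.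
rewrite -[index_block p']setIid -[X in X :&: _]E setI_eq0.
by rewrite index_block_disjoint // eq_sym.
Qed.

Lemma sum_block_index (F : 'I_d -> nat) (Q : pred 'I_d) :
  (\sum_(p : block_index | Q (tag p)) F (tag p) = \sum_(e < d | Q e) mu e * F e)%N.
Proof.
rewrite [RHS](eq_bigr (fun e => \sum_(nu < mu e) F e)%N); last first.
  by move=> e _; rewrite sum_nat_const card_ord.
by rewrite sig_big_dep; apply: eq_bigl => p; rewrite andbT.
Qed.

(** The blocks are disjoint and nonempty; they cover everything because their sizes add up to
    [kappa]. *)
Lemma partition_base : partition base_partition setT.
Proof.
have disj : {in predT &, forall p p',
    p' != p -> [disjoint index_block p & index_block p']}.
  by move=> p p' _ _; exact: index_block_disjoint.
have [partB _] := indexed_partition disj (fun p _ => index_block_neq0 p).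
have baseE : [set index_block p | p in predT] = base_partition.
  by apply/setP => B; apply/imsetP/imsetP => -[p _ ->]; exists p.
rewrite baseE in partB; suff <- : cover base_partition = setT by [].
apply/eqP; rewrite eqEcard subsetT cardsT card_ord (card_partition partB).
rewrite big_imset /=; last by move=> p p' _ _; exact: index_block_inj.
under eq_bigr do rewrite card_index_block.
rewrite (sum_block_index (fun e => lam e) predT).
by case/andP: lam_mu => _ /eqP ->.
Qed.

Lemma card_base_partition : #|base_partition| = (\sum_(e < d) mu e)%N.
Proof.
rewrite card_imset; last exact: index_block_inj.
rewrite -sum1_card (sum_block_index (fun=> 1%N) predT).
by apply: eq_bigr => e _; rewrite muln1.
Qed.

(** The sum has at most one term, [lam] being injective; this form spares a case distinction on
    whether [k] is a value of [lam]. *)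
Lemma size_count_base k :
  size_count base_partition k = (\sum_(e < d | lam e == k :> nat) mu e)%N.
Proof.
rewrite (eq_bigr (fun e => mu e * 1)%N); last by move=> e _; rewrite muln1.
rewrite -(sum_block_index (fun=> 1%N) (fun e => lam e == k :> nat)) sum1_card.
rewrite /size_count -(card_imset _ index_block_inj).
apply: eq_card => B; rewrite inE; apply/andP/imsetP.
  move=> [/imsetP[p _ ->]]; rewrite card_index_block => pk.
  by exists p.
by move=> [p pk ->]; rewrite imset_f // card_index_block.
Qed.

(** Since [lam] is injective, the size of a block of [base_partition] identifies its [e]. *)
Lemma blocksE e :
  blocks kappa_gt0 lam mu e = [set B in base_partition | #|B| == lam e].
Proof.
apply/setP => B; rewrite [RHS]inE; apply/imsetP/andP.
  move=> [nu _ ->]; pose p : block_index := Tagged (fun e => 'I_(mu e)) nu.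
  by rewrite -[block _ _ _]/(index_block p) imset_f // card_index_block.
move=> [/imsetP[[e' nu] _ ->]]; rewrite card_index_block /= => /eqP/lam_inj ee'.
by case: e / ee'; exists nu.
Qed.

(** Permutations preserve block sizes, so by [blocksE] stabilizing the blocks of each [e] separately
    is the same as stabilizing [base_partition]. *)
Lemma block_permsP (h : 'S_kappa) :
  reflect (perm_partition h base_partition = base_partition)
          (h \in block_perms kappa_gt0 lam mu).
Proof.
have inj : injective (fun B : {set T} => h @: B) := imset_inj (@perm_inj _ h).
rewrite inE; apply: (iffP forallP) => [stable|stable e].
  apply/eqP; rewrite eqEcard (card_imset _ inj) leqnn andbT.
  apply/subsetP => _ /imsetP[_ /imsetP[[e nu] _ ->] ->].
  have : h @: block kappa_gt0 lam nu \in blocks kappa_gt0 lam mu e.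
    by rewrite -(eqP (stable e)); do 2 apply: imset_f.
  by rewrite blocksE inE => /andP[].
rewrite eqEcard (card_imset _ inj) leqnn andbT blocksE.
apply/subsetP => _ /imsetP[B + ->]; rewrite !inE => /andP[BP Be].
rewrite card_imset; last exact: perm_inj.
have := imset_f (fun C : {set T} => h @: C) BP.
by rewrite -/(perm_partition h base_partition) stable Be andbT.
Qed.

Definition has_type P : bool :=
  partition P setT &&
  [forall k : 'I_kappa.+1,
     size_count P k == (\sum_(e < d | lam e == k :> nat) mu e)%N].

(** The partitions of a given type form one orbit, by [perm_partition_transitive]. Sizes above
    [kappa], left out of [has_type], have count 0 on both sides. *)
Lemma has_typeP P :
  reflect (exists s : 'S_kappa, P = perm_partition s base_partition)
          (has_type P).
Proof.
apply: (iffP andP) => [[partP /forallP sizeP]|[s ->]]; last first.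
  rewrite partition_perm partition_base; split=> //.
  by apply/forallP => k; rewrite size_count_perm size_count_base.
apply: perm_partition_transitive => // [|k]; first exact: partition_base.
rewrite size_count_base.
case: (ltnP k kappa.+1) => [lek|ltk]; first by rewrite (eqP (sizeP (Ordinal lek))).
rewrite big_pred0; last first.
  by move=> e; apply/negbTE; rewrite neq_ltn (leq_trans (ltn_ord (lam e)) ltk).
symmetry; apply/eqP; rewrite cards_eq0; apply/eqP/setP => B; rewrite !inE.
apply/negbTE; rewrite negb_and; apply/orP; right; rewrite neq_ltn.
by rewrite (leq_ltn_trans (max_card _)) // card_ord.
Qed.

Lemma card_has_type P : has_type P -> #|P| = (\sum_(e < d) mu e)%N.
Proof.
move=> /has_typeP[s ->]; rewrite card_imset ?card_base_partition //.
exact: imset_inj (@perm_inj _ s).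
Qed.

Lemma size_count_type P k :
  has_type P -> size_count P k = (\sum_(e < d | lam e == k :> nat) mu e)%N.
Proof. by move=> /has_typeP[s ->]; rewrite size_count_perm size_count_base. Qed.

Lemma size_count_lam P e : has_type P -> size_count P (lam e) = mu e.
Proof.
move=> typeP; rewrite size_count_type // (big_pred1 e) // => e' /=.
by rewrite (inj_eq lam_inj).
Qed.

Lemma mem_lam P k : has_type P ->
  (k \in [seq (lam e : nat) | e : 'I_d]) = (0 < size_count P k)%N.
Proof.
move=> typeP; apply/imageP/idP => [[e _ ->]|].
  by rewrite size_count_lam //; case/andP: lam_mu => /forallP.
rewrite size_count_type // lt0n sum_nat_eq0 => /forallPn[e].
by rewrite negb_imply => /andP[/eqP <- _]; exists e.
Qed.

Lemma sorted_lam : sorted ltn [seq (lam e : nat) | e : 'I_d].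
Proof.
rewrite sorted_map; apply: (sub_sorted (e := relpre val ltn)).
  by move=> e e' /lam_lt.
by rewrite -sorted_map val_enum_ord iota_ltn_sorted.
Qed.

(** Orbit and stabilizer: two permutations send [base_partition] to the same partition exactly when
    they lie in the same right coset of [block_perms], and [S] meets each coset once. *)
Lemma sum_coset_representatives (R : nmodType) (S : {set 'S_kappa})
    (W : {set {set T}} -> R) :
  coset_representatives kappa_gt0 lam mu S ->
  \sum_(s in S) W (perm_partition s base_partition) =
  \sum_(P : {set {set T}} | has_type P) W P.
Proof.
move=> trS.
have [partH _ /forall_inP meetS] := and3P trS.
have mem_coset s : (block_perms kappa_gt0 lam mu :* s)%g \in
    rcosets (block_perms kappa_gt0 lam mu) [set: 'S_kappa].
  by apply/rcosetsP; exists s; rewrite ?inE.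
have pblockE s : pblock (rcosets (block_perms kappa_gt0 lam mu) [set: 'S_kappa]) s
    = (block_perms kappa_gt0 lam mu :* s)%g.
  apply: def_pblock => //; first exact: partition_trivIset partH.
  exact: rcoset_refl.
have inj : {in S &, injective (fun s => perm_partition s base_partition)}.
  move=> s t sS tS /= E; apply: (pblock_inj trS) => //.
  (* Equal images mean that [s * t^-1] fixes [base_partition]. *)
  rewrite !pblockE; apply/rcoset_eqP; rewrite mem_rcoset.
  apply/block_permsP; rewrite perm_partitionM E -perm_partitionM mulgV.
  exact: perm_partition1.
rewrite -(big_imset W inj) /=; apply: eq_bigl => P.
apply/imsetP/has_typeP => [[s _ ->]|[t ->]]; first by exists s.
have /cards1P[s sE] := meetS _ (mem_coset t).
have : s \in S :&: (block_perms kappa_gt0 lam mu :* t)%g by rewrite sE inE.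
rewrite inE => /andP[sS /rcosetP[h /block_permsP hB sht]].
by exists s => //; rewrite sht perm_partitionM hB.
Qed.

(** [F] and [D] are kept apart because the theorem lists the indices of a block in the order of the
    triples, whereas [block_partial] uses [enum]. *)
Lemma big_base_partition (R : comPzSemiRingType) (s : 'S_kappa) (D : {set T} -> R)
    (F : forall e, 'I_(mu e) -> R) :
  (forall e (nu : 'I_(mu e)), F e nu = D (s @: block kappa_gt0 lam nu)) ->
  \prod_(e < d) \prod_(nu < mu e) F e nu =
  \prod_(B in perm_partition s base_partition) D B.
Proof.
move=> FD; rewrite big_imset /=; last first.
  by move=> B C _ _; exact: imset_inj (@perm_inj _ s) B C.
rewrite big_imset /=; last by move=> p p' _ _; exact: index_block_inj.
by rewrite sig_big_dep; apply: eq_bigr => -[e nu] _; exact: FD.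
Qed.

Lemma perm_enum_block (s : 'S_kappa) e (nu : 'I_(mu e)) :
  perm_eq [seq s (triple nu gamma) | gamma <- enum 'I_(lam e)]
          (enum (s @: block kappa_gt0 lam nu)).
Proof.
pose p : block_index := Tagged (fun e => 'I_(mu e)) nu.
apply: uniq_perm; rewrite ?enum_uniq //.
  rewrite map_inj_uniq ?enum_uniq // => gamma gamma' /perm_inj E.
  exact: (val_inj (triple_inj (p := p) (p' := p) E).2).
move=> x; rewrite mem_enum -imset_comp.
apply/mapP/imsetP => -[gamma _ ->]; exists gamma => //.
by rewrite mem_enum.
Qed.

End BasePartition.

(** * Classification of the partitions by their type *)

Section Types.
Import boot.fintype boot.finset.
Variables (kappa : nat).
Hypothesis kappa_gt0 : (0 < kappa)%N.
Local Notation types d :=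
  ({ffun 'I_d -> 'I_kappa.+1} * {ffun 'I_d -> 'I_kappa.+1})%type.
Implicit Types (P : {set {set 'I_kappa}}).

Definition of_type P d (q : types d) : bool :=
  [&& increasing q.1, multiplicities q.1 q.2 & has_type q.1 q.2 P].

(** The values of [lam] are the block sizes of [P] in increasing order, which fixes [d] and [lam];
    then [mu e] counts the blocks of size [lam e]. As [d] varies too, the equality is one of
    dependent pairs. *)
Lemma of_type_unique P d d' (q : types d) (q' : types d') :
  of_type P q -> of_type P q' -> existT (fun d => types d) d q = existT _ d' q'.
Proof.
case: q q' => [lam mu] [lam' mu'] /and3P[/= inc mult ty] /and3P[/= inc' mult' ty'].
have lamE : [seq (lam e : nat) | e : 'I_d] = [seq (lam' e : nat) | e : 'I_d'].
  apply: (irr_sorted_eq ltn_trans ltnn); try exact: sorted_lam.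
  by move=> k; rewrite (mem_lam kappa_gt0 _ _ _ ty) //
    (mem_lam kappa_gt0 _ _ _ ty').
have dd' : d = d' by have := congr1 size lamE; rewrite !size_image !card_ord.
case: d' / dd' lam' mu' inc' mult' ty' lamE =>
  lam' mu' inc' mult' ty' /eq_in_map lamE.
have E : lam = lam'.
  by apply/ffunP => e; apply: val_inj; apply: lamE; rewrite mem_enum.
suff -> : mu = mu' by rewrite E.
apply/ffunP => e; apply: val_inj.
rewrite /= -(size_count_lam kappa_gt0 inc mult e ty).
by rewrite -(size_count_lam kappa_gt0 inc' mult' e ty') E.
Qed.

(** [A] is the set of block sizes, [d] its cardinality, [lam] its increasing enumeration, and [mu]
    counts the blocks of each size. *)
Lemma of_type_exists P : partition P setT ->
  exists d (q : types d), (0 < d <= kappa)%N /\ of_type P q.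
Proof.
move=> partP; pose A := [set k : 'I_kappa.+1 | 0 < size_count P k]%N.
have sum_sizes : (\sum_(B in P) #|B| = kappa)%N.
  by rewrite -(card_partition partP) cardsT card_ord.
have block_gt0 B : B \in P -> (0 < #|B|)%N.
  by move=> BP; rewrite card_gt0 (partition_neq0 partP).
have count0 : size_count P 0 = 0%N.
  apply/eqP; rewrite cards_eq0; apply/eqP/setP => B; rewrite !inE.
  by apply/negbTE/negP => /andP[/block_gt0]; rewrite lt0n => /negPf ->.
have count_le k : (size_count P k <= kappa)%N.
  apply: (@leq_trans #|P|).
    by apply: subset_leq_card; apply/subsetP => B; rewrite inE => /andP[].
  by rewrite -sum1_card; apply: leq_trans (eq_leq sum_sizes); exact: leq_sum.
pose lam := [ffun e : 'I_#|A| => enum_val e].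
(* [inord] keeps the value since, by [count_le], a count of blocks is at most [kappa]. *)
pose mu := [ffun e : 'I_#|A| => inord (size_count P (lam e)) : 'I_kappa.+1].
have muE e : mu e = size_count P (lam e) :> nat by rewrite ffunE inordK // ltnS.
have lamA e : lam e \in A by rewrite ffunE enum_valP.
exists #|A|, (lam, mu); split.
  apply/andP; split.
    have xP : Ordinal kappa_gt0 \in cover P by rewrite (cover_partition partP) inE.
    apply/card_gt0P; exists (inord #|pblock P (Ordinal kappa_gt0)|).
    rewrite inE inordK; last by rewrite ltnS (leq_trans (max_card _)) ?card_ord.
    apply/card_gt0P; exists (pblock P (Ordinal kappa_gt0)).
    by rewrite inE eqxx pblock_mem.
  (* The size 0 does not occur, so there are at most [kappa] sizes. *)
  apply: (@leq_trans #|[set~ (ord0 : 'I_kappa.+1)]|);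
    last by rewrite cardsC1 card_ord.
  apply: subset_leq_card; apply/subsetP => k; rewrite !inE.
  by apply: contraTneq => ->; rewrite count0.
apply/and3P; split => /=.
- apply/andP; split; apply/forallP => e.
    have := lamA e; rewrite inE; apply: contraTT.
    by rewrite -leqNgt leqn0 => /eqP ->; rewrite count0.
  apply/forallP => e'; apply/implyP => ee'; rewrite !ffunE.
  rewrite !(enum_val_nth ord0).
  have sA : sorted (relpre val ltn) (enum A).
    rewrite /enum_mem; apply: sorted_filter.
      by move=> a b c; exact: ltn_trans.
    by rewrite -enumT -sorted_map val_enum_ord iota_ltn_sorted.
  apply: (sorted_ltn_nth (leT := relpre val ltn) _ ord0 sA) => //.
  + by move=> a b c; exact: ltn_trans.
  + by rewrite inE -cardE ltn_ord.
  + by rewrite inE -cardE ltn_ord.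
- apply/andP; split.
    by apply/forallP => e; rewrite muE; have := lamA e; rewrite inE.
  apply/eqP; under eq_bigr do rewrite muE ffunE.
  rewrite -(big_enum_val (fun k : 'I_kappa.+1 => size_count P k * k)%N).
  transitivity (\sum_(B in P) #|B|)%N; last exact: sum_sizes.
  (* The blocks are grouped by size: those of size [k] contribute [size_count P k * k]. *)
  rewrite [RHS](partition_big
    (fun B : {set 'I_kappa} => inord #|B| : 'I_kappa.+1) predT) //=.
  rewrite big_mkcond; apply: eq_bigr => k _.
  transitivity (size_count P k * k)%N.
    by rewrite inE; case: posnP => // ->.
  rewrite /size_count -sum_nat_const; apply: congr_big => // B.
    rewrite inE; congr (_ && _); rewrite -val_eqE /= inordK //.
    by rewrite ltnS (leq_trans (max_card _)) ?card_ord.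
  by rewrite inE => /andP[_ /eqP].
(* At most one [e] has [lam e = k]; it exists when [k] is in [A], and otherwise the count is 0. *)
rewrite /has_type partP; apply/forallP => k.
under eq_bigr do rewrite muE ffunE.
under eq_bigl do rewrite ffunE.
rewrite -(big_enum_val_cond (fun x : 'I_kappa.+1 => x == k :> nat)
  (fun x : 'I_kappa.+1 => size_count P x)).
case: (boolP (k \in A)) => kA.
  rewrite (big_pred1 k) // => x /=; rewrite andb_idl // => /eqP/val_inj ->.
  exact: kA.
rewrite big_pred0 => [|x]; first by move: kA; rewrite inE -leqNgt leqn0.
by apply/negbTE; apply: contra kA => /andP[xA /eqP/val_inj <-].
Qed.

(** Each partition has exactly one type, with [d] between 1 and [kappa], so after the sums are
    exchanged the inner ones reduce to a single term. *)
Lemma sum_over_types (R : nmodType) (W : {set {set 'I_kappa}} -> R) :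
  \sum_(1 <= d < kappa.+1)
  \sum_(lam : {ffun 'I_d -> 'I_kappa.+1} | increasing lam)
  \sum_(mu : {ffun 'I_d -> 'I_kappa.+1} | multiplicities lam mu)
  \sum_(P : {set {set 'I_kappa}} | has_type lam mu P) W P =
  \sum_(P : {set {set 'I_kappa}} | partition P setT) W P.
Proof.
transitivity (\sum_(1 <= d < kappa.+1)
    \sum_(P : {set {set 'I_kappa}} | partition P setT)
    \sum_(q : types d | of_type P q) W P).
  apply: eq_bigr => d _; rewrite pair_big_dep /=.
  rewrite (exchange_big_dep (fun P => partition P setT)) /=; last first.
    by move=> q P _ /andP[].
  by apply: eq_bigr => P _; apply: eq_bigl => q; rewrite -andbA.
rewrite exchange_big /=; apply: eq_bigr => P partP.
have [d [q [d_bound typeq]]] := of_type_exists partP.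
rewrite (bigD1_seq d) ?mem_index_iota ?iota_uniq //=.
rewrite [X in _ + X]big1 ?addr0 => [|d' d'd]; last first.
  rewrite big_pred0 // => q'; apply: contraNF d'd => typeq'.
  by have /(congr1 (@projT1 _ _)) /= <- := of_type_unique typeq typeq'.
rewrite (big_pred1 q) // => q' /=; apply/idP/eqP => [typeq'|-> //].
by have := of_type_unique typeq' typeq => /eqP; rewrite eq_Tagged => /eqP.
Qed.

End Types.

Theorem theorem3p79 (R : realType) (K : numFieldType)
    (K_real_or_complex : K = R \/ K = R[i])
    (n : nat) (n_gt0 : (0 < n)%N)
    (g : 'rV[K]_n -> K) (g_smooth : smooth g)
    (f : K -> K) (f_smooth : smooth1 f)
    (kappa : nat) (kappa_gt0 : (0 < kappa)%N) (i : 'I_kappa -> 'I_n)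
    (F : forall d : nat, {ffun 'I_d -> 'I_kappa.+1} ->
           {ffun 'I_d -> 'I_kappa.+1} -> {set 'S_kappa})
    (F_representatives :
      forall (d : nat) (lam mu : {ffun 'I_d -> 'I_kappa.+1}),
        (1 <= d <= kappa)%N -> increasing lam -> multiplicities lam mu ->
        coset_representatives kappa_gt0 lam mu (F d lam mu))
    (x : 'rV[K]_n) :
  partials [seq i j | j <- enum 'I_kappa] (f \o g) x =
  \sum_(1 <= d < kappa.+1)
  \sum_(lam : {ffun 'I_d -> 'I_kappa.+1} | increasing lam)
  \sum_(mu : {ffun 'I_d -> 'I_kappa.+1} | multiplicities lam mu)
    derive1n (\sum_(e < d) mu e) f (g x) *
    \sum_(sigma in F d lam mu)
      \prod_(e < d) \prod_(nu < mu e)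
        partials
          [seq i (sigma (triple kappa_gt0 nu gamma)) | gamma <- enum 'I_(lam e)]
          g x.
Proof.
have g_perm s1 s2 := partials_perm (s1 := s1) (s2 := s2) K_real_or_complex g_smooth.
rewrite (faa_di_bruno_partitions i g_smooth f_smooth g_perm (enum_uniq _)).
have -> : [set j in enum 'I_kappa] = [set: 'I_kappa].
  by apply/setP => j; rewrite !inE mem_enum.
rewrite -(sum_over_types kappa_gt0); apply: eq_big_nat => d d_bound.
apply: eq_bigr => lam lam_inc; apply: eq_bigr => mu lam_mu.
have repr := F_representatives d lam mu d_bound lam_inc lam_mu.
(* The sum over the partitions of this type becomes the sum over [F d lam mu]. *)
rewrite -(sum_coset_representatives lam_inc lam_mu _ repr) mulr_sumr.
apply: eq_bigr => sigma _; rewrite /partition_term.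
have -> : #|perm_partition sigma (base_partition kappa_gt0 lam mu)| =
    (\sum_(e < d) mu e)%N.
  apply: (card_has_type kappa_gt0 lam_inc lam_mu).
  by apply/(has_typeP kappa_gt0 lam_inc lam_mu); exists sigma.
congr (_ * _); symmetry.
apply: (big_base_partition lam_inc lam_mu (D := fun B => block_partial g i B x)).
move=> e nu; rewrite /block_partial.
(* The two orders of differentiation inside a block, by triples and by [enum], are reconciled by
   symmetry. *)
congr (_ x); apply: g_perm; rewrite (map_comp i (fun gamma => sigma _)).
by apply: perm_map; exact: perm_enum_block.
Qed.
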